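(* Let $K$ be an algebraically closed field and let $Q$ be a quiver. Then the lattice $\mathscr{C}(S_Q)$ of all congruences on the path semigroup $S_Q$ and the lattice $\mathcal{SI}(KQ)$ of all special algebraic ideals of the path algebra $KQ$ (both ordered by inclusion) are isomorphic.
   Context: A quiver $Q=(Q_0,Q_1,s,t)$ consists of a set $Q_0$ of vertices, a set $Q_1$ of arrows, and source and target maps $s,t:Q_1\to Q_0$; it is arbitrary (not necessarily finite). Paths are finite and include the trivial path $e$ at each vertex (identified with the vertex); each path $\alpha$ has a source $s(\alpha)$ and a target $t(\alpha)$. Paths are composed from left to right: $\alpha\beta$ is the concatenation if $t(\alpha)=s(\beta)$ and is $0$ otherwise; so $s(\alpha)\alpha=\alpha=\alpha t(\alpha)$. The path semigroup $S_Q$ is the semigroup with zero whose nonzero elements are all paths in $Q$, with this multiplication. The path algebra $KQ$ is the $K$-algebra with basis the set of all paths and multiplication extending that of $S_Q$ (the zero of $S_Q$ is the zero of $KQ$); it need not have an identity if $Q_0$ is infinite. A congruence on a semigroup $S$ is an equivalence relation $\rho$ such that $(x,y)\in\rho$ implies $(ax,ay)\in\rho$ and $(xa,ya)\in\rho$ for all $a\in S$. $\mathscr{C}(S_Q)$ is the set of all congruences on $S_Q$, which is a complete lattice under inclusion. An algebraic ideal of $KQ$ is a two-sided ideal of the algebra $KQ$; $\langle A\rangle$ is the smallest one containing $A$. A special relation in $KQ$ is either a monomial relation, i.e. a path $\alpha$, or a commutative relation, i.e. an element $\alpha-\beta$ with $\alpha\neq\beta$ paths such that $s(\alpha)=s(\beta)$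 and $t(\alpha)=t(\beta)$. An algebraic ideal is special if it is zero or can be generated by special relations. $\mathcal{SI}(KQ)$ is the set of all special algebraic ideals of $KQ$ ordered by inclusion; it is a complete lattice, where the join is the sum of ideals and the meet of a family is the ideal generated by all special relations lying in the intersection of the family. Two lattices $L_1,L_2$ are isomorphic if there is a bijection $\phi:L_1\to L_2$ such that $a\le b$ in $L_1$ if and only if $\phi(a)\le\phi(b)$ in $L_2$. *)

(* Defs.v *)
From HB Require Import structures.
From mathcomp Require Import all_boot all_order all_algebra.
From mathcomp Require Import finmap.
From mathcomp Require Import boolp classical_sets functions.
From mathcomp Require Import monalg.

Set Implicit Arguments.
Unset Strict Implicit.
Unset Printing Implicit Defensive.

Import GRing.Theory.

Local Open Scope classical_set_scope.
Local Open Scope ring_scope.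

Record quiver := Quiver {
  vertex : Type;
  arrow : Type;
  source : arrow -> vertex;
  target : arrow -> vertex
}.

Section Paths.
Variable Q : quiver.
Implicit Types (v : vertex Q) (s : seq (arrow Q)).

Fixpoint walk v s : Prop :=
  if s is a :: s' then source a = v /\ walk (target a) s' else True.

Definition walk_end v s : vertex Q := last v (map (@target Q) s).

(* The trivial path at v is the one with source v and no arrow. *)
Record qpath := QPath {
  path_source : vertex Q;
  path_arrows : seq (arrow Q);
  path_walk : walk path_source path_arrows
}.

HB.instance Definition _ := gen_eqMixin qpath.
HB.instance Definition _ := gen_choiceMixin qpath.

Definition path_target (p : qpath) : vertex Q :=
  walk_end (path_source p) (path_arrows p).

Lemma path_inj (p q : qpath) : path_source p = path_source q ->
  path_arrows p = path_arrows q -> p = q.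
Proof.
case: p q => [v s ps] [w t qt] /= vw st; case: _ / vw in qt *.
by case: _ / st in qt *; congr QPath; exact: Prop_irrelevance.
Qed.

Lemma walk_cat v s1 s2 :
  walk v s1 -> walk (walk_end v s1) s2 -> walk v (s1 ++ s2).
Proof.
by elim: s1 v => [|a s1 IHs] v //= [av ws1] ws2; split=> //; exact: IHs.
Qed.

Lemma walk_end_cat v s1 s2 :
  walk_end v (s1 ++ s2) = walk_end (walk_end v s1) s2.
Proof. by rewrite /walk_end map_cat last_cat. Qed.

Lemma path_cat_subproof (p q : qpath) : path_target p = path_source q ->
  walk (path_source p) (path_arrows p ++ path_arrows q).
Proof.
move=> pq; apply: walk_cat; first exact: path_walk.
by rewrite -/(path_target p) pq; exact: path_walk.
Qed.

Definition path_cat (p q : qpath) (pq : path_target p = path_source q) : qpath :=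
  QPath (path_cat_subproof pq).

(* The path semigroup: None is its zero. *)
Definition path_semigroup : Type := option qpath.

HB.instance Definition _ := Choice.on path_semigroup.

Definition path_mul (x y : path_semigroup) : path_semigroup :=
  if x is Some p then
    if y is Some q then
      if pselect (path_target p = path_source q) is left pq
      then Some (path_cat pq) else None
    else None
  else None.

Lemma path_mulP (p q : qpath) (pq : path_target p = path_source q) :
  path_mul (Some p) (Some q) = Some (path_cat pq).
Proof.
by rewrite /path_mul; case: pselect => [pq'|//]; congr Some; exact: path_inj.
Qed.

Lemma path_mul0P (p q : qpath) : path_target p <> path_source q ->
  path_mul (Some p) (Some q) = None.
Proof. by rewrite /path_mul; case: pselect. Qed.

Lemma path_mulx0 (x : path_semigroup) : path_mul x None = None.
Proof. by case: x. Qed.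

Lemma path_target_cat (p q : qpath) (pq : path_target p = path_source q) :
  path_target (path_cat pq) = path_target q.
Proof.
by rewrite /path_target /path_cat /= walk_end_cat -/(path_target p) pq.
Qed.

Lemma path_mulA : associative path_mul.
Proof.
case=> [p|] // [q|] [r|] //; last by rewrite !path_mulx0.
have [qr|qr] := pselect (path_target q = path_source r); last first.
  rewrite (path_mul0P qr) path_mulx0.
  have [pq|pq] := pselect (path_target p = path_source q).
    by rewrite (path_mulP pq) path_mul0P // path_target_cat.
  by rewrite (path_mul0P pq).
rewrite (path_mulP qr).
have [pq|pq] := pselect (path_target p = path_source q); last first.
  by rewrite (path_mul0P pq) path_mul0P.
have pqr : path_target p = path_source (path_cat qr) by [].
have pqr' : path_target (path_cat pq) = path_source r by rewrite path_target_cat.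
rewrite (path_mulP pq) (path_mulP pqr) (path_mulP pqr').
by congr Some; apply: path_inj; rewrite //= catA.
Qed.

HB.instance Definition _ := isSemigroup.Build path_semigroup path_mulA.

End Paths.

Definition is_congruence (S : semigroupType) (rho : set (S * S)) : Prop :=
  [/\ forall x, rho (x, x),
      forall x y, rho (x, y) -> rho (y, x),
      forall x y z, rho (x, y) -> rho (y, z) -> rho (x, z) &
      forall a x y, rho (x, y) ->
        rho ((a * x)%g, (a * y)%g) /\ rho ((x * a)%g, (y * a)%g)].

Definition congruences (S : semigroupType) : set (set (S * S)) :=
  [set rho | is_congruence rho].

Arguments congruences S : clear implicits.

Section PathAlgebra.
Variables (K : fieldType) (Q : quiver).

Definition path_algebra : Type := {malg K[qpath Q]}.

HB.instance Definition _ := GRing.Lmodule.on path_algebra.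

Implicit Types (f g : path_algebra) (A I : set path_algebra).

Definition basis_path (p : qpath Q) : path_algebra := << p >>.

Definition path_embed (x : path_semigroup Q) : path_algebra :=
  if x is Some p then basis_path p else 0.

Definition path_algebra_mul f g : path_algebra :=
  \sum_(p <- msupp f) \sum_(q <- msupp g)
    (f@_p * g@_q) *:
      path_embed ((Some p : path_semigroup Q) * (Some q : path_semigroup Q))%g.

Lemma path_algebra_mulEw (dom1 dom2 : {fset qpath Q}) f g :
    (msupp f `<=` dom1)%fset -> (msupp g `<=` dom2)%fset ->
  path_algebra_mul f g = \sum_(p <- dom1) \sum_(q <- dom2)
    (f@_p * g@_q) *:
      path_embed ((Some p : path_semigroup Q) * (Some q : path_semigroup Q))%g.
Proof.
move=> le1 le2; rewrite /path_algebra_mul (big_fset_incl _ le1) /=; last first.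
  move=> p _ pf; rewrite big1 // => q _.
  by rewrite mcoeff_outdom // mul0r scale0r.
apply: eq_bigr => p _; rewrite (big_fset_incl _ le2) //= => q _ qg.
by rewrite (mcoeff_outdom qg) mulr0 scale0r.
Qed.

Lemma path_algebra_mulDl : left_distributive path_algebra_mul +%R.
Proof.
move=> f g h.
have le0 := fsubset_refl (msupp h).
rewrite (path_algebra_mulEw (msuppD_le f g) le0).
rewrite (path_algebra_mulEw (fsubsetUl (msupp f) (msupp g)) le0).
rewrite (path_algebra_mulEw (fsubsetUr (msupp f) (msupp g)) le0).
rewrite -big_split; apply: eq_bigr => p _ /=.
rewrite -big_split; apply: eq_bigr => q _ /=.
by rewrite mcoeffD mulrDl scalerDl.
Qed.

Lemma path_algebra_mulDr : right_distributive path_algebra_mul +%R.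
Proof.
move=> h f g.
have le0 := fsubset_refl (msupp h).
rewrite (path_algebra_mulEw le0 (msuppD_le f g)).
rewrite (path_algebra_mulEw le0 (fsubsetUl (msupp f) (msupp g))).
rewrite (path_algebra_mulEw le0 (fsubsetUr (msupp f) (msupp g))).
rewrite -big_split; apply: eq_bigr => p _ /=.
rewrite -big_split; apply: eq_bigr => q _ /=.
by rewrite mcoeffD mulrDr scalerDl.
Qed.

Lemma path_algebra_mulZl (c : K) f g :
  path_algebra_mul (c *: f) g = c *: path_algebra_mul f g.
Proof.
rewrite (path_algebra_mulEw (msuppZ_le c f) (fsubset_refl (msupp g))).
rewrite scaler_sumr; apply: eq_bigr => p _.
rewrite scaler_sumr; apply: eq_bigr => q _.
by rewrite mcoeffZ scalerA mulrA.
Qed.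

Lemma path_algebra_mulZr (c : K) f g :
  path_algebra_mul f (c *: g) = c *: path_algebra_mul f g.
Proof.
rewrite (path_algebra_mulEw (fsubset_refl (msupp f)) (msuppZ_le c g)).
rewrite scaler_sumr; apply: eq_bigr => p _.
rewrite scaler_sumr; apply: eq_bigr => q _.
by rewrite mcoeffZ scalerA mulrCA.
Qed.

Lemma path_algebra_mul0l f : path_algebra_mul 0 f = 0.
Proof. by rewrite -[in LHS](scale0r (0 : path_algebra)) path_algebra_mulZl scale0r. Qed.

Lemma path_algebra_mul0r f : path_algebra_mul f 0 = 0.
Proof. by rewrite -[in LHS](scale0r (0 : path_algebra)) path_algebra_mulZr scale0r. Qed.

Lemma path_embedM (x y : path_semigroup Q) :
  path_embed (x * y)%g = path_algebra_mul (path_embed x) (path_embed y).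
Proof.
case: x y => [p|] [q|]; rewrite ?path_algebra_mul0l ?path_algebra_mul0r //.
rewrite /path_algebra_mul /= !msuppU oner_eq0 !big_seq_fset1 !mcoeffUU mulr1.
by rewrite scale1r.
Qed.

Lemma path_algebra_suml (J : Type) (r : seq J) (F : J -> path_algebra) g :
  path_algebra_mul (\sum_(i <- r) F i) g =
  \sum_(i <- r) path_algebra_mul (F i) g.
Proof.
by apply: (big_morph (path_algebra_mul^~ g)) => [f h|];
  rewrite ?path_algebra_mulDl ?path_algebra_mul0l.
Qed.

Lemma path_algebra_sumr (J : Type) (r : seq J) (F : J -> path_algebra) g :
  path_algebra_mul g (\sum_(i <- r) F i) =
  \sum_(i <- r) path_algebra_mul g (F i).
Proof.
by apply: (big_morph (path_algebra_mul g)) => [f h|];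
  rewrite ?path_algebra_mulDr ?path_algebra_mul0r.
Qed.

Lemma path_algebraE f :
  f = \sum_(p <- msupp f) f@_p *: path_embed (Some p).
Proof.
rewrite {1}[f]monalgE; apply: eq_bigr => p _; apply/malgP => q.
by rewrite mcoeffZ !mcoeffU mulrnAr mulr1.
Qed.

Lemma path_algebra_mulA : associative path_algebra_mul.
Proof.
move=> f g h; rewrite (path_algebraE f).
rewrite (path_algebra_suml _ _ (path_algebra_mul g h)).
rewrite (path_algebra_suml _ _ g) (path_algebra_suml _ _ h).
apply: eq_bigr => p _; rewrite !path_algebra_mulZl.
apply: (congr1 ( *:%R f@_p)).
rewrite (path_algebraE g) (path_algebra_suml _ _ h).
rewrite 2!(path_algebra_sumr (msupp g)) (path_algebra_suml _ _ h).
apply: eq_bigr => q _.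
rewrite path_algebra_mulZl !path_algebra_mulZr path_algebra_mulZl.
apply: (congr1 ( *:%R g@_q)).
rewrite (path_algebraE h) 3!(path_algebra_sumr (msupp h)).
apply: eq_bigr => r _; rewrite !path_algebra_mulZr.
apply: (congr1 ( *:%R h@_r)).
by rewrite -4!path_embedM [(_ * (_ * _))%g]path_mulA.
Qed.

Definition is_algebraic_ideal I : Prop :=
  [/\ I 0,
      forall f g, I f -> I g -> I (f + g),
      forall (c : K) f, I f -> I (c *: f) &
      forall f g, I f -> I (path_algebra_mul g f) /\ I (path_algebra_mul f g)].

Definition generated_ideal A : set path_algebra := smallest is_algebraic_ideal A.

Definition monomial_relation f : Prop := exists p : qpath Q, f = basis_path p.

Definition commutative_relation f : Prop :=
  exists p q : qpath Q,
    [/\ p <> q, path_source p = path_source q, path_target p = path_target q &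
        f = basis_path p - basis_path q].

Definition special_relation : set path_algebra :=
  [set f | monomial_relation f \/ commutative_relation f].

Definition is_special_ideal I : Prop :=
  is_algebraic_ideal I /\
  (I = [set 0] \/ exists2 A, A `<=` special_relation & I = generated_ideal A).

Definition special_ideals : set (set path_algebra) :=
  [set I | is_special_ideal I].

End PathAlgebra.

Arguments special_ideals K Q : clear implicits.

Definition inclusion_isomorphic (T U : Type) (L1 : set (set T))
    (L2 : set (set U)) : Prop :=
  exists2 phi : set T -> set U, set_bij L1 L2 phi &
    forall a b, L1 a -> L1 b -> (a `<=` b <-> phi a `<=` phi b).

(* Main.v *)
Require Import Defs.
From mathcomp Require Import all_boot all_order all_algebra.
From mathcomp Require Import finmap.
From mathcomp Require Import boolp classical_sets functions.
From mathcomp Require Import monalg.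

(** A congruence [rho] is sent to the ideal generated by the differences
    [x - y] with [rho (x, y)], and an ideal [I] to the congruence
    [x - y \in I].  The ideal of [rho] yields [rho] back: an [x] that is related
    neither to [y] nor to [0] is separated from [y] by the linear form
    counting the paths congruent to [x], and the common kernel of all linear
    forms compatible with [rho] is an ideal.  Conversely a special ideal is
    generated by differences, as a path is [p - 0]; and a difference [p - q] of
    paths with distinct endpoints generates the same ideal as [p] and [q], by
    multiplication with trivial paths. *)

Set Implicit Arguments.
Unset Strict Implicit.
Unset Printing Implicit Defensive.

Import GRing.Theory.

Local Open Scope classical_set_scope.
Local Open Scope ring_scope.

(** * Trivial paths as local units *)

Definition trivial_path (Q : quiver) (v : vertex Q) : qpath Q :=
  @QPath Q v [::] Logic.I.

Section TrivialPaths.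
Variable Q : quiver.
Implicit Types (v : vertex Q) (p : qpath Q).

Lemma trivial_path_mull v p : path_source p = v ->
  path_mul (Some (trivial_path v)) (Some p) = Some p.
Proof.
move=> pv; have vp : path_target (trivial_path v) = path_source p by [].
by rewrite (path_mulP vp); congr Some; apply: path_inj.
Qed.

Lemma trivial_path_mull0 v p : path_source p <> v ->
  path_mul (Some (trivial_path v)) (Some p) = None.
Proof. by move=> pv; apply: path_mul0P => vp; apply: pv. Qed.

Lemma trivial_path_mulr v p : path_target p = v ->
  path_mul (Some p) (Some (trivial_path v)) = Some p.
Proof.
move=> pv; have pv' : path_target p = path_source (trivial_path v) by [].
by rewrite (path_mulP pv'); congr Some; apply: path_inj; rewrite //= cats0.
Qed.

Lemma trivial_path_mulr0 v p : path_target p <> v ->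
  path_mul (Some p) (Some (trivial_path v)) = None.
Proof. by move=> pv; apply: path_mul0P. Qed.

End TrivialPaths.

Section CongruencesAndIdeals.
Variables (K : fieldType) (Q : quiver).

Local Notation S := (path_semigroup Q).
Local Notation KQ := (path_algebra K Q).
Local Notation "f ** g" := (path_algebra_mul f g) (at level 40).
Local Notation E := (@path_embed K Q).

Implicit Types (f g : KQ) (A I : set KQ) (rho : set (S * S)).

(** * Ideals of the path algebra and the congruences they define *)

Lemma path_algebra_mulBl f g h : (f - g) ** h = f ** h - g ** h.
Proof. by rewrite -scaleN1r path_algebra_mulDl path_algebra_mulZl scaleN1r. Qed.

Lemma path_algebra_mulBr f g h : h ** (f - g) = h ** f - h ** g.
Proof. by rewrite -scaleN1r path_algebra_mulDr path_algebra_mulZr scaleN1r. Qed.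

Lemma generated_ideal_ideal A : is_algebraic_ideal (generated_ideal A).
Proof.
split.
- by move=> I [[]].
- move=> f g Af Ag I HI; have [[_ ID _ _] _] := HI.
  exact: ID (Af I HI) (Ag I HI).
- move=> c f Af I HI; have [[_ _ IZ _] _] := HI.
  exact: IZ (Af I HI).
- by move=> f g Af; split=> I HI; have [[_ _ _ IM] _] := HI;
    have [] := IM f g (Af I HI).
Qed.

Lemma ideal_sub I f g : is_algebraic_ideal I -> I f -> I g -> I (f - g).
Proof.
by move=> [_ ID IZ _] If Ig; rewrite -scaleN1r; apply: ID => //; apply: IZ.
Qed.

Lemma ideal_congruence I : is_algebraic_ideal I ->
  is_congruence [set xy : S * S | I (E xy.1 - E xy.2)].
Proof.
move=> HI; have [I0 ID IZ IM] := HI; split=> /=.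
- by move=> x; rewrite subrr.
- by move=> x y Ixy; rewrite -opprB -scaleN1r; apply: IZ.
- by move=> x y z Ixy Iyz; rewrite -(subrKA (E y)); apply: ID.
- move=> a x y Ixy; rewrite !path_embedM -path_algebra_mulBr -path_algebra_mulBl.
  exact: IM.
Qed.

(** The trivial path at an end of [p] that [q] does not share fixes [p] and kills [q], when
    multiplied on the side of that end. *)
Lemma ideal_difference_endpoints I (p q : qpath Q) : is_algebraic_ideal I ->
  I (E (Some p) - E (Some q)) ->
  ~ (path_source p = path_source q /\ path_target p = path_target q) ->
  I (E (Some p)).
Proof.
move=> HI Ipq npq; have [_ _ _ IM] := HI.
have [spq|spq] := pselect (path_source p = path_source q).
  have tpq : path_target q <> path_target p by move=> tpq; apply: npq.
  have [_] := IM _ (E (Some (trivial_path (path_target p)))) Ipq.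
  rewrite path_algebra_mulBl -!path_embedM.
  by rewrite [(_ * _)%g]trivial_path_mulr // [(_ * _)%g]trivial_path_mulr0 // subr0.
have [+ _] := IM _ (E (Some (trivial_path (path_source p)))) Ipq.
rewrite path_algebra_mulBr -!path_embedM.
rewrite [(_ * _)%g]trivial_path_mull // [(_ * _)%g]trivial_path_mull0 ?subr0 //.
by move=> /esym.
Qed.

(** A difference of parallel paths is zero or itself a special relation. In the other cases every
    path occurring in the difference lies in [I], hence is a monomial relation there. *)
Lemma ideal_difference_special I (x y : S) : is_algebraic_ideal I ->
  I (E x - E y) ->
  generated_ideal (I `&` @special_relation K Q) (E x - E y).
Proof.
move=> HI; set G := generated_ideal _.
have GI : is_algebraic_ideal G by exact: generated_ideal_ideal.
have IG f : I f -> special_relation f -> G f.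
  by move=> If sf J [_]; apply; split.
have [_ _ IZ _] := HI; have [G0 _ GZ _] := GI.
have IGpath p : I (E (Some p)) -> G (E (Some p)).
  by move=> Ip; apply: IG => //; left; exists p.
case: x y => [p|] [q|] Ixy.
- have [<-|npq] := pselect (p = q); first by rewrite subrr.
  have [[spq tpq]|nst] :=
    pselect (path_source p = path_source q /\ path_target p = path_target q).
    by apply: IG => //; right; exists p, q.
  apply: (ideal_sub GI); apply: IGpath.
    exact: ideal_difference_endpoints nst.
  apply: (@ideal_difference_endpoints _ q p) => //.
    by rewrite -opprB -scaleN1r; apply: IZ.
  by move=> [/esym spq /esym tpq]; apply: nst.
- by move: Ixy; rewrite /= subr0; apply: IGpath.
- rewrite /= sub0r -scaleN1r; apply: GZ; apply: IGpath.
  by move/(IZ (-1)): Ixy; rewrite scaleN1r sub0r opprK.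
- by rewrite subrr.
Qed.

Lemma special_relation_difference f : special_relation f ->
  exists x y : S, f = E x - E y.
Proof.
case=> [[p ->]|[p [q [_ _ _ ->]]]]; last by exists (Some p), (Some q).
by exists (Some p), None; rewrite subr0.
Qed.

(** * The ideal of a congruence *)

Definition congruence_ideal rho : set KQ :=
  generated_ideal [set f | exists x y : S, rho (x, y) /\ f = E x - E y].

Lemma congruence_ideal_mem rho (x y : S) :
  rho (x, y) -> congruence_ideal rho (E x - E y).
Proof. by move=> rxy I [_]; apply; exists x, y. Qed.

Lemma congruence_ideal_sub rho I : is_algebraic_ideal I ->
  (forall x y, rho (x, y) -> I (E x - E y)) -> congruence_ideal rho `<=` I.
Proof. by move=> HI rI f; apply; split=> // _ [x [y [rxy ->]]]; apply: rI. Qed.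

Lemma congruence_ideal_special rho : is_special_ideal (congruence_ideal rho).
Proof.
have HI : is_algebraic_ideal (congruence_ideal rho).
  exact: generated_ideal_ideal.
split=> //; right.
(* The defining generators need not be special, so all special relations of the ideal are taken
   instead. *)
exists (congruence_ideal rho `&` @special_relation K Q); first by move=> f [].
apply/seteqP; split.
  apply: congruence_ideal_sub; first exact: generated_ideal_ideal.
  by move=> x y /congruence_ideal_mem; apply: ideal_difference_special.
by move=> f; apply; split=> // g [].
Qed.

Lemma special_ideal_congruence I : is_special_ideal I ->
  congruence_ideal [set xy : S * S | I (E xy.1 - E xy.2)] = I.
Proof.
move=> [HI genI]; apply/seteqP; split; first exact: congruence_ideal_sub.
have HJ : is_algebraic_ideal
  (congruence_ideal [set xy : S * S | I (E xy.1 - E xy.2)]).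
  exact: generated_ideal_ideal.
case: genI => [I0|[A sA IA]]; first by rewrite {1}I0 => f /= ->; case: HJ.
rewrite {1}IA => f; apply; split=> // g Ag.
have [x [y gE]] := special_relation_difference (sA g Ag).
(* A generator [g] of [I] is a difference lying in [I], so its two terms are congruent modulo
   [I]. *)
rewrite gE; apply: congruence_ideal_mem => /=; rewrite -gE IA.
by move=> J [_]; apply.
Qed.

(** * Linear forms compatible with a congruence *)

Definition coeff_sum (h : S -> K) f : K :=
  \sum_(p <- msupp f) f@_p * h (Some p).

Lemma coeff_sumEw (h : S -> K) (dom : {fset qpath Q}) f :
  (msupp f `<=` dom)%fset -> coeff_sum h f = \sum_(p <- dom) f@_p * h (Some p).
Proof.
move=> fd; rewrite /coeff_sum (big_fset_incl _ fd) //= => p _ pf.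
by rewrite mcoeff_outdom // mul0r.
Qed.

Lemma coeff_sumD (h : S -> K) f g :
  coeff_sum h (f + g) = coeff_sum h f + coeff_sum h g.
Proof.
rewrite (coeff_sumEw _ (msuppD_le f g)).
rewrite (coeff_sumEw _ (fsubsetUl (msupp f) (msupp g))).
rewrite (coeff_sumEw _ (fsubsetUr (msupp f) (msupp g))) -big_split.
by apply: eq_bigr => p _; rewrite mcoeffD mulrDl.
Qed.

Lemma coeff_sumZ (h : S -> K) (c : K) f :
  coeff_sum h (c *: f) = c * coeff_sum h f.
Proof.
rewrite (coeff_sumEw _ (msuppZ_le c f)) mulr_sumr.
by apply: eq_bigr => p _; rewrite mcoeffZ mulrA.
Qed.

(** The sum runs over paths only and never sees [h None]; since [E None] is zero, that value has to
    vanish. *)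
Lemma coeff_sum_embed (h : S -> K) (x : S) :
  h None = 0 -> coeff_sum h (E x) = h x.
Proof.
case: x => [p|] h0; rewrite /coeff_sum /=; last by rewrite msupp0 big_seq_fset0.
by rewrite msuppU oner_eq0 big_seq_fset1 mcoeffUU mul1r.
Qed.

Definition compatible_form rho (L : KQ -> K) : Prop :=
  [/\ forall f g, L (f + g) = L f + L g,
      forall c f, L (c *: f) = c * L f &
      forall x y, rho (x, y) -> L (E x) = L (E y)].

(** By linearity [g] may be replaced by a path, and multiplication by a path preserves [rho]. *)
Lemma compatible_form_mul rho (L : KQ -> K) g :
  is_congruence rho -> compatible_form rho L ->
  compatible_form rho (fun f => L (g ** f)) /\
  compatible_form rho (fun f => L (f ** g)).
Proof.
move=> [_ _ _ rM] [LD LZ Lr].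
have L0 : L 0 = 0 by rewrite -(scale0r 0) LZ mul0r.
have Lsum (r : seq (qpath Q)) (F : qpath Q -> KQ) :
    L (\sum_(p <- r) F p) = \sum_(p <- r) L (F p).
  by apply: (big_morph L) => // f f'; rewrite LD.
split; split.
- by move=> f f'; rewrite path_algebra_mulDr LD.
- by move=> c f; rewrite path_algebra_mulZr LZ.
- move=> x y rxy; rewrite (path_algebraE g) !path_algebra_suml !Lsum.
  apply: eq_bigr => p _; rewrite !path_algebra_mulZl !LZ -!path_embedM.
  by congr (_ * _); apply: Lr; have [] := rM (Some p) _ _ rxy.
- by move=> f f'; rewrite path_algebra_mulDl LD.
- by move=> c f; rewrite path_algebra_mulZl LZ.
- move=> x y rxy; rewrite (path_algebraE g) !path_algebra_sumr !Lsum.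
  apply: eq_bigr => p _; rewrite !path_algebra_mulZr !LZ -!path_embedM.
  by congr (_ * _); apply: Lr; have [] := rM (Some p) _ _ rxy.
Qed.

(** The kernel of one form is merely a subspace. The common kernel absorbs products because a
    compatible form composed with a multiplication is again compatible. *)
Lemma compatible_form_kernel_ideal rho : is_congruence rho ->
  is_algebraic_ideal [set f | forall L, compatible_form rho L -> L f = 0].
Proof.
move=> Hr; split=> /=.
- by move=> L [_ LZ _]; rewrite -(scale0r 0) LZ mul0r.
- by move=> f g f0 g0 L HL; have [LD _ _] := HL; rewrite LD f0 // g0 // addr0.
- by move=> c f f0 L HL; have [_ LZ _] := HL; rewrite LZ f0 // mulr0.
- by move=> f g f0; split=> L /(compatible_form_mul g Hr)[gL Lg];
    [apply: f0 gL | apply: f0 Lg].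
Qed.

Lemma congruence_ideal_form rho L f : is_congruence rho ->
  compatible_form rho L -> congruence_ideal rho f -> L f = 0.
Proof.
move=> Hr HL /(congruence_ideal_sub (compatible_form_kernel_ideal Hr)).
apply=> // x y rxy L' [LD LZ Lr].
by rewrite -scaleN1r LD LZ mulN1r (Lr _ _ rxy) subrr.
Qed.

Lemma congruence_ideal_separates rho (x y : S) : is_congruence rho ->
  ~ rho (x, None) -> congruence_ideal rho (E x - E y) -> rho (x, y).
Proof.
move=> Hr nx Ixy; have [rR rS rT _] := Hr.
(* The indicator of the class of [x]; it vanishes at [None] precisely because [x] is not congruent
   to zero. *)
pose h (z : S) : K := (`[< rho (x, z) >])%:R.
have h0 : h None = 0 by rewrite /h asboolF.
have HL : compatible_form rho (coeff_sum h).
  split; [exact: coeff_sumD | exact: coeff_sumZ |].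
  move=> z t rzt; rewrite !coeff_sum_embed //; congr (_%:R); congr nat_of_bool.
  by apply: asbool_equiv_eq; split=> xz; apply: rT xz _ => //; apply: rS.
(* The form takes the value [1 - h y] on [E x - E y]; if [y] were outside the class, this would give
   [1 = 0] in [K]. *)
have := congruence_ideal_form Hr HL Ixy.
rewrite -scaleN1r coeff_sumD coeff_sumZ !coeff_sum_embed //.
rewrite /h asboolT //; case: asboolP => // _.
by rewrite mulr0 addr0 => /eqP; rewrite oner_eq0.
Qed.

(** * Recovering the congruence, and the order isomorphism *)

Lemma congruence_idealP rho (x y : S) : is_congruence rho ->
  congruence_ideal rho (E x - E y) <-> rho (x, y).
Proof.
move=> Hr; split; last exact: congruence_ideal_mem.
move=> Ixy; have [_ rS rT _] := Hr.
have [x0|nx] := pselect (rho (x, None)); last exact: congruence_ideal_separates.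
(* If both elements are congruent to zero, transitivity suffices; if only [x] is, the roles are
   exchanged and the class of [y] separates. *)
have [y0|ny] := pselect (rho (y, None)); first by apply: rT x0 _; apply: rS.
apply: rS; apply: congruence_ideal_separates => //.
rewrite -opprB -scaleN1r.
by have [_ _ IZ _] := generated_ideal_ideal
  [set f | exists x y : S, rho (x, y) /\ f = E x - E y]; apply: IZ.
Qed.

Lemma congruence_ideal_le rho sigma : is_congruence rho -> is_congruence sigma ->
  rho `<=` sigma <-> congruence_ideal rho `<=` congruence_ideal sigma.
Proof.
move=> Hr Hs; split=> [rs|IJ [x y] rxy].
  apply: congruence_ideal_sub; first exact: generated_ideal_ideal.
  by move=> x y /rs; apply: congruence_ideal_mem.
apply: (congruence_idealP x y Hs).1; apply: IJ.
exact: congruence_ideal_mem rxy.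
Qed.

End CongruencesAndIdeals.

Theorem theorem1p1 (K : closedFieldType) (Q : quiver) :
  inclusion_isomorphic (congruences (path_semigroup Q)) (special_ideals K Q).
Proof.
exists (@congruence_ideal K Q); last first.
  by move=> rho sigma; apply: (@congruence_ideal_le K Q).
split.
- by move=> rho _; apply: congruence_ideal_special.
(* Injectivity follows from reflecting inclusion in both directions. *)
- move=> rho sigma /set_mem Hr /set_mem Hs IJ.
  apply/seteqP; split.
    by apply: (congruence_ideal_le K Hr Hs).2; rewrite IJ.
  by apply: (congruence_ideal_le K Hs Hr).2; rewrite IJ.
- move=> I HI; exists [set xy | I (path_embed K xy.1 - path_embed K xy.2)].
    by apply: ideal_congruence; case: HI.
  exact: special_ideal_congruence.
Qed.
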